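(* Let $s=(u_1,u_2,u_3)$ be an admissible state of $L$ with $|N(u_i)|\le B$ for $i=1,2,3$ and $u_1\ne u_2$, $u_2\ne u_3$. Then $$\frac{x_1}{x_2}\ge1+\frac1{4B},\qquad \frac{x_2}{x_3}\ge1+\frac1{4B}.$$
   Context: $K$ is a cubic number field of signature $(1,1)$, with real embedding $\sigma_r$ and field norm $N$; $L\subset\mathcal O_K$ is an order. A state of $L$ is an ordered triple $(u_1,u_2,u_3)$ of elements of $L$ forming a $\mathbb Q$-basis of $K$; it is admissible if $x_i=\sigma_r(u_i)>0$ for all $i$, and sorted so that $x_1\ge x_2\ge x_3>0$. *)

(* Defs.v *)
From HB Require Import structures.
From mathcomp Require Import all_boot all_order all_algebra all_field.
From mathcomp Require Import complex.
From mathcomp Require Import all_classical all_reals.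

Set Implicit Arguments.
Unset Strict Implicit.
Unset Printing Implicit Defensive.

Import Order.TTheory GRing.Theory Num.Theory.

Local Open Scope classical_set_scope.
Local Open Scope card_scope.
Local Open Scope ring_scope.

(* A number field is a [fieldExtType rat], i.e. a finite extension of rat,
   of degree [\dim {:K}]. *)

(* Ring homomorphisms as bare functions, so that they can be counted. *)
Definition embeddings (K F : fieldType) : set (K -> F) :=
  [set f | zmod_morphism f /\ monoid_morphism f].
Arguments embeddings : clear implicits.

Definition has_signature (R : realType) (K : fieldExtType rat) (r1 r2 : nat) :=
  embeddings K R #= `I_r1 /\
  [set f | embeddings K R[i] f /\ exists x, f x \isn't Num.real] #= `I_(r2.*2).

Definition field_norm (K : fieldExtType rat) (x : K) : rat :=
  \det (passmx.mxof (vbasis {:K}) (vbasis {:K}) (amull x)).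

(* Integrality of the elements of [L] follows from the other two conditions; it
   is kept so that the definition literally says "subring of O_K". *)
Definition is_order (K : fieldExtType rat) (L : {pred K}) : Prop :=
  [/\ subring_closed L,
      {in L, forall x, integralOver (intr : int -> K) x}
    & exists2 e : (\dim {:K}).-tuple K,
        basis_of {:K} e & forall x, x \in L <-> inIntSpan e x].

Definition is_state (K : fieldExtType rat) (L : {pred K}) (u1 u2 u3 : K) : Prop :=
  [/\ u1 \in L, u2 \in L, u3 \in L & basis_of {:K} [:: u1; u2; u3]].

Definition admissible (R : realType) (K : fieldExtType rat)
    (sigma_r : {rmorphism K -> R}) (u1 u2 u3 : K) : Prop :=
  [/\ 0 < sigma_r u1, 0 < sigma_r u2, 0 < sigma_r u3
    & sigma_r u3 <= sigma_r u2 /\ sigma_r u2 <= sigma_r u1].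

(* Main.v *)
Require Import Defs.
From HB Require Import structures.
From mathcomp Require Import all_boot all_order all_algebra all_field.
From mathcomp Require Import complex.
From mathcomp Require Import all_classical all_reals.
From mathcomp Require Import ring lra.

Set Implicit Arguments.
Unset Strict Implicit.
Unset Printing Implicit Defensive.

Import Order.TTheory GRing.Theory Num.Theory.

Local Open Scope ring_scope.

(** Let [tau] be a non-real embedding of [K].  Because [K] is cubic, its
embeddings are [sigma_r], [tau] and the conjugate of [tau], so
[N w = sigma_r w * |tau w|^2] for every [w] in [K].  Let [u <> v] be elements
of the order with [x = sigma_r u >= y = sigma_r v > 0] and norms at most [B] in
absolute value.  Then [|tau u|^2 <= B / x <= B / y] and [|tau v|^2 <= B / y],
so [|tau (u - v)|^2 <= 2 |tau u|^2 + 2 |tau v|^2 <= 4 B / y].  The norm of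
[u - v] is a nonzero integer, hence
[1 <= |N (u - v)| = (x - y) * |tau (u - v)|^2 <= (x / y - 1) * 4 B],
which is the bound.

Both facts about the norm come from [det_mul_coord]: in any rational basis of
[K], the matrix of multiplication by [w] has determinant equal to the product
of the conjugates of [w].  The matrix of the values of the embeddings at the
basis vectors diagonalizes the multiplication matrix, and it is invertible by
Dedekind's independence of embeddings.  Since the product of the conjugates
does not see the basis, the determinant defining the norm may be computed in a
[Z]-basis of the order, where the multiplication matrix is integral. *)

(** * Independence of embeddings *)

Lemma embeddings_rmorphism (K F : fieldType) (f : K -> F) :
  embeddings K F f -> exists g : {rmorphism K -> F}, g =1 f.
Proof.
move=> [fB fM].
pose fZ := GRing.isZmodMorphism.Build _ _ f fB.
pose fR := GRing.isMonoidMorphism.Build _ _ f fM.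
pose g : {rmorphism K -> F} := HB.pack f fZ fR.
by exists g.
Qed.

(** Dedekind's independence of characters.  A relation over [A] is shortened at
[j] by comparing its value at [b * a] with [s j b] times its value at [a]; the
new coefficient at [i] is [c i] times [s i b - s j b], which is nonzero for a
suitable [b]. *)
Lemma rmorphism_independent (I : finType) (K F : fieldType)
    (s : I -> {rmorphism K -> F})
    (s_neq : forall i j, i != j -> exists a, s i a != s j a)
    (A : {set I}) (c : I -> F) :
  (forall a, \sum_(i in A) c i * s i a = 0) -> forall i, i \in A -> c i = 0.
Proof.
have [n] := ubnP #|A|; elim: n A c => // n IHn A c ltAn c0 i iA.
have [j /andP[ji jA] | noj] := pickP (fun j => (j != i) && (j \in A)).
  have [b sb] : exists b, s i b != s j b by apply: s_neq; rewrite eq_sym.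
  have ltA : (#|A :\ j| < n)%N by move: ltAn; rewrite (cardsD1 j A) jA.
  have d0 a : \sum_(k in A :\ j) (c k * (s k b - s j b)) * s k a = 0.
    transitivity (\sum_(k in A) c k * s k (b * a)
                  - s j b * \sum_(k in A) c k * s k a); last first.
      by rewrite !c0 mulr0 subr0.
    rewrite mulr_sumr -sumrB [RHS](big_setD1 j jA) /= rmorphM.
    rewrite mulrCA subrr add0r; apply: eq_bigr => k _; rewrite rmorphM; ring.
  have /eqP : c i * (s i b - s j b) = 0.
    by apply: (IHn _ _ ltA d0); rewrite in_setD1 eq_sym ji.
  by rewrite mulf_eq0 subr_eq0 (negPf sb) orbF => /eqP.
have := c0 1; rewrite (big_setD1 i iA) /= big1 ?addr0 ?rmorph1 ?mulr1 //.
by move=> k; rewrite in_setD1 noj.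
Qed.

Lemma rmorph_ratZ (K : fieldExtType rat) (F : numFieldType)
    (s : {rmorphism K -> F}) (q : rat) (a : K) : s (q *: a) = ratr q * s a.
Proof.
rewrite -mulr_algl rmorphM; congr (_ * _).
exact: (fmorph_eq_rat (s \o in_alg K)).
Qed.

(** As many distinct embeddings as basis vectors form an invertible matrix: a
vector in the kernel would be a linear relation between the embeddings, first
at the basis vectors and then, by rational linearity, everywhere. *)
Lemma embedding_mx_unit (K : fieldExtType rat) (F : numFieldType) (n : nat)
    (e : n.-tuple K) (e_basis : basis_of {:K} e) (s : 'I_n -> {rmorphism K -> F})
    (s_neq : forall i j, i != j -> exists a, s i a != s j a) :
  (\matrix_(i < n, j < n) s j e`_i) \in unitmx.
Proof.
rewrite -unitmx_tr unitmxE unitfE; apply/negP => /det0P[c c_neq0 cV0].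
case/eqP: c_neq0; apply/rowP => k; rewrite mxE.
apply: (rmorphism_independent s_neq (A := [set: 'I_n]) (c := c 0)) => // a.
rewrite (coord_basis e_basis (memvf a)).
under eq_bigr => j _.
  rewrite rmorph_sum mulr_sumr.
  under eq_bigr => i _ do rewrite rmorph_ratZ mulrCA.
  over.
rewrite exchange_big big1 // => i _; rewrite -mulr_sumr.
have := congr1 (fun M : 'rV_n => M 0 i) cV0; rewrite !mxE => ci0.
rewrite (_ : \sum_(_ in _) _ = 0) ?mulr0 // -[RHS]ci0.
by apply: eq_big => [j|j _]; rewrite ?inE ?mxE.
Qed.

(** * The norm as the product of the conjugates *)

(** With [V] the matrix of the values of the embeddings at the basis, the
hypothesis on [M] says that [M *m V] is [V] times the diagonal matrix of the
conjugates of [w].  The right-hand side of the conclusion does not mention [e],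
so the lemma also shows that the determinant does not depend on the basis. *)
Lemma det_mul_coord (K : fieldExtType rat) (F : numFieldType) (n : nat)
    (e : n.-tuple K) (e_basis : basis_of {:K} e) (s : 'I_n -> {rmorphism K -> F})
    (s_neq : forall i j, i != j -> exists a, s i a != s j a)
    (w : K) (M : 'M[rat]_n) :
  (forall i : 'I_n, w * e`_i = \sum_j M i j *: e`_j) ->
  ratr (\det M) = \prod_i s i w.
Proof.
move=> wE; set V := \matrix_(i < n, j < n) s j e`_i.
have VU : V \in unitmx := embedding_mx_unit e_basis s_neq.
have MV : map_mx ratr M *m V = V *m diag_mx (\row_j s j w).
  apply/matrixP => i j; rewrite mul_mx_diag !mxE mulrC -rmorphM wE rmorph_sum.
  by apply: eq_bigr => k _; rewrite !mxE rmorph_ratZ.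
have detV : \det V != 0 by rewrite -unitfE -unitmxE.
apply: (mulIf detV); rewrite -det_map_mx -det_mulmx MV det_mulmx det_diag mulrC.
by congr (_ * _); apply: eq_bigr => j _; rewrite mxE.
Qed.

Lemma field_norm_prod (K : fieldExtType rat) (F : numFieldType)
    (s : 'I_(\dim {:K}) -> {rmorphism K -> F})
    (s_neq : forall i j, i != j -> exists a, s i a != s j a) (w : K) :
  ratr (field_norm w) = \prod_i s i w.
Proof.
have vB := vbasisP {:K}; apply: (det_mul_coord vB s_neq) => i.
rewrite [LHS](coord_basis vB (memvf _)); apply: eq_bigr => j _.
by rewrite !mxE /= passmx.vecof_delta lfunE.
Qed.

(** Multiplication by [w] preserves [L], so in a [Z]-basis of [L] its matrix has
integer entries. *)
Lemma order_norm_int (K : fieldExtType rat) (F : numFieldType)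
    (s : 'I_(\dim {:K}) -> {rmorphism K -> F})
    (s_neq : forall i j, i != j -> exists a, s i a != s j a)
    (L : {pred K}) (orderL : is_order L) (w : K) :
  w \in L -> exists d : int, field_norm w = d%:~R.
Proof.
move=> wL; have [[_ _ LM] _ [e e_basis eL]] := orderL.
have wM (i : 'I_(\dim {:K})) : exists a : int ^ \dim {:K},
    w * e`_i = \sum_(j < \dim {:K}) e`_j *~ a j.
  (* The basis vectors themselves belong to [L]. *)
  apply/eL/LM => //; apply/eL; exists [ffun j => (j == i)%:Z].
  rewrite (bigD1 i) //= ffunE eqxx mulr1z big1 ?addr0 // => j ji.
  by rewrite ffunE (negPf ji) mulr0z.
have [a aE] := choice wM.
exists (\det (\matrix_(i, j) a i j)); rewrite -det_map_mx.
apply: (fmorph_inj (ratr : {rmorphism rat -> F})) => /=.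
rewrite (field_norm_prod s_neq); apply/esym/(det_mul_coord e_basis s_neq) => i.
by rewrite aE; apply: eq_bigr => j _; rewrite !mxE scaler_int.
Qed.

Lemma order_norm_ge1 (K : fieldExtType rat) (F : numFieldType)
    (s : 'I_(\dim {:K}) -> {rmorphism K -> F})
    (s_neq : forall i j, i != j -> exists a, s i a != s j a)
    (L : {pred K}) (orderL : is_order L) (w : K) :
  w \in L -> w != 0 -> 1 <= `|field_norm w|.
Proof.
move=> wL w0; have [d dE] := order_norm_int s_neq orderL wL.
have : field_norm w != 0.
  rewrite -(fmorph_eq0 (ratr : {rmorphism rat -> F})) /= (field_norm_prod s_neq).
  by apply/prodf_neq0 => i _; rewrite fmorph_eq0.
by rewrite dE intr_eq0 -intr_norm (ler_int _ 1) -normr_gt0 gtz0_ge1.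
Qed.

(** * Cubic fields with a real and a non-real embedding *)

Lemma nonreal_embedding (R : realType) (K : fieldExtType rat) (r1 r2 : nat) :
    has_signature R K r1 r2 -> (0 < r2)%N ->
  exists tau : {rmorphism K -> R[i]}, exists x, tau x \isn't Num.real.
Proof.
move=> [_ card_nonreal] r2_gt0; have [f [fK [x fx]]] :
    exists f, embeddings K R[i] f /\ exists x, f x \isn't Num.real.
  apply: contrapT => noF; move: card_nonreal.
  rewrite (_ : [set _ | _] = set0)%classic.
    rewrite card_eq_sym card_eq0 => /eqP/seteqP[/(_ 0%N) /= + _].
    by rewrite double_gt0; apply.
  by apply/seteqP; split=> // f fP; apply: noF; exists f.
by have [tau tauE] := embeddings_rmorphism fK; exists tau, x; rewrite tauE.
Qed.

(** The index is a natural number rather than an ordinal so that a product over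
ordinals below [\dim {:K}] becomes a product over three indices by rewriting
the dimension. *)
Definition mixed_embeddings (R : realType) (K : fieldType)
    (sigma : {rmorphism K -> R}) (tau : {rmorphism K -> R[i]}) (i : nat) :
    {rmorphism K -> R[i]} :=
  nth (real_complex R \o sigma : {rmorphism K -> R[i]})
    [:: (real_complex R \o sigma : {rmorphism K -> R[i]}); tau;
        (@conjc R \o tau : {rmorphism K -> R[i]})] i.

(** At a point where [tau] takes a value with imaginary part [b <> 0], the three
embeddings take values with imaginary parts [0], [b] and [- b]. *)
Lemma mixed_embeddings_neq (R : realType) (K : fieldType)
    (sigma : {rmorphism K -> R}) (tau : {rmorphism K -> R[i]}) (n : nat) :
    (exists x, tau x \isn't Num.real) -> (n <= 3)%N ->
  forall i j : 'I_n, i != j ->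
    exists a, mixed_embeddings sigma tau i a != mixed_embeddings sigma tau j a.
Proof.
move=> [x tx] n_le3 i j; rewrite -val_eqE /= => ij; exists x.
have i_lt3 := leq_trans (ltn_ord i) n_le3.
have j_lt3 := leq_trans (ltn_ord j) n_le3.
case tauxE: (tau x) tx => [a b]; rewrite complex_real => /eqP b_neq0.
apply/eqP => /(congr1 (@complex.Im R)); rewrite /mixed_embeddings.
case: (val i) (val j) ij i_lt3 j_lt3 => [|[|[|k]]] [|[|[|l]]] //= _ _ _;
  rewrite tauxE /= => bE; case: b_neq0; lra.
Qed.

Definition sqnorm (R : realType) (z : R[i]) : R :=
  complex.Re z ^+ 2 + complex.Im z ^+ 2.

Lemma mixed_cubic_norm (R : realType) (K : fieldExtType rat)
    (cubicK : \dim {:K} = 3%N)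
    (sigma : {rmorphism K -> R}) (tau : {rmorphism K -> R[i]})
    (tau_nonreal : exists x, tau x \isn't Num.real) (w : K) :
  ratr (field_norm w) = sigma w * sqnorm (tau w).
Proof.
have dim_le3 : (\dim {:K} <= 3)%N by rewrite cubicK.
apply: (fmorph_inj (real_complex R)); rewrite /= fmorph_rat.
rewrite (field_norm_prod (mixed_embeddings_neq sigma tau_nonreal dim_le3)).
rewrite cubicK !big_ord_recl big_ord0 mulr1 rmorphM /=; congr (_ * _).
case: (tau w) => a b; apply/eqP; rewrite eq_complex /sqnorm /=.
by apply/andP; split; apply/eqP; ring.
Qed.

(** * Ratios of conjugates *)

(** Here [p], [q] and [r] stand for the squared absolute values of the non-real
conjugates of [u], [v] and [u - v]. *)
Lemma ratio_bound (R : realType) (x y p q r B : R) :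
    0 < y -> y <= x -> 0 <= p ->
    x * p <= B -> y * q <= B -> r <= 2 * p + 2 * q -> 1 <= (x - y) * r ->
  1 + 1 / (4 * B) <= x / y.
Proof.
move=> y_gt0 le_yx p_ge0 xp yq rpq xyr.
have yr : y * r <= 4 * B.
  have : y * p <= x * p by rewrite ler_wpM2r.
  have : y * r <= y * (2 * p + 2 * q) by rewrite ler_pM2l.
  lra.
have key : y <= (x - y) * (4 * B).
  have : y * 1 <= y * ((x - y) * r) by rewrite ler_pM2l.
  have : (x - y) * (y * r) <= (x - y) * (4 * B) by rewrite ler_wpM2l ?subr_ge0.
  lra.
(* Otherwise [(x - y) * (4 * B)] would not be positive, against [key]. *)
have B_gt0 : 0 < 4 * B by nra.
rewrite ler_pdivlMr // -(ler_pM2r B_gt0).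
have -> : (1 + 1 / (4 * B)) * y * (4 * B) = y * (4 * B) + y.
  by field; lra.
lra.
Qed.

Lemma consecutive_ratio (R : realType) (K : fieldExtType rat)
    (cubicK : \dim {:K} = 3%N)
    (sigma : {rmorphism K -> R}) (tau : {rmorphism K -> R[i]})
    (tau_nonreal : exists x, tau x \isn't Num.real)
    (L : {pred K}) (orderL : is_order L) (B : R) (u v : K) :
    u \in L -> v \in L -> u <> v ->
    0 < sigma v -> sigma v <= sigma u ->
    ratr `|field_norm u| <= B -> ratr `|field_norm v| <= B ->
  1 + 1 / (4 * B) <= sigma u / sigma v.
Proof.
move=> uL vL uv v_gt0 le_vu Nu Nv.
have dim_le3 : (\dim {:K} <= 3)%N by rewrite cubicK.
have sq_ge0 z : 0 <= sqnorm z :> R by rewrite addr_ge0 ?sqr_ge0.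
have N_le w : ratr `|field_norm w| <= B -> sigma w * sqnorm (tau w) <= B.
  rewrite ratr_norm (mixed_cubic_norm cubicK sigma tau_nonreal).
  exact/le_trans/ler_norm.
apply: (ratio_bound v_gt0 le_vu (sq_ge0 (tau u))
  (N_le _ Nu) (N_le _ Nv) (r := sqnorm (tau (u - v)))).
  (* [|z - w|^2 <= 2 |z|^2 + 2 |w|^2], the gap being [|z + w|^2]. *)
  rewrite rmorphB /sqnorm !raddfB /=.
  have := sqr_ge0 (complex.Re (tau u) + complex.Re (tau v)).
  have := sqr_ge0 (complex.Im (tau u) + complex.Im (tau v)).
  lra.
have [[_ LB _] _ _] := orderL.
have := order_norm_ge1 (mixed_embeddings_neq sigma tau_nonreal dim_le3) orderL
  (LB _ _ uL vL).
rewrite subr_eq0 => /(_ (introN eqP uv)).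
rewrite -(ler_rat R) rmorph1 ratr_norm.
rewrite (mixed_cubic_norm cubicK sigma tau_nonreal) rmorphB ger0_norm //.
by rewrite mulr_ge0 // subr_ge0.
Qed.

Theorem lemma6p6 (R : realType) (K : fieldExtType rat)
    (cubicK : \dim {:K} = 3%N) (sigK : has_signature R K 1 1)
    (sigma_r : {rmorphism K -> R})
    (L : {pred K}) (orderL : is_order L)
    (u1 u2 u3 : K) (state_u : is_state L u1 u2 u3)
    (adm_u : admissible sigma_r u1 u2 u3)
    (B : R)
    (N1 : ratr `|field_norm u1| <= B) (N2 : ratr `|field_norm u2| <= B)
    (N3 : ratr `|field_norm u3| <= B)
    (u12 : u1 <> u2) (u23 : u2 <> u3) :
  sigma_r u1 / sigma_r u2 >= 1 + 1 / (4 * B) /\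
  sigma_r u2 / sigma_r u3 >= 1 + 1 / (4 * B).
Proof.
have [tau tau_nonreal] := nonreal_embedding sigK isT.
have [u1L u2L u3L _] := state_u.
have [_ x2_gt0 x3_gt0 [le32 le21]] := adm_u.
by split; apply: (consecutive_ratio cubicK tau_nonreal orderL).
Qed.
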